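(* Let $M$ be a term of the language $\mathbf{PCF}^{\mathbf{list}}$ such that $x_1:\mathtt{bit},\ldots,x_n:\mathtt{bit}\vdash M:\mathtt{bit}^m$ is derivable. Suppose that $$\mathit{EmptyAM}(M)\;\to_{am}^*\;(\langle p_{i_1},\ldots,p_{i_k}\rangle,\ (I,C),\ L),$$ where $p_{i_1},\ldots,p_{i_k}$ are variables. Then $k=m$, and for every family of booleans $\vec u=(b_i)_{i\in I}$ (where $I=\{1,\ldots,n\}$) and all booleans $c_1,\ldots,c_m$: the term $T(\langle p_{i_1},\ldots,p_{i_k}\rangle,(I,C),L)(\vec u)$ is equal to $\langle c_1,\ldots,c_m\rangle$ if and only if the term $\mathtt{let}\ \langle x_1,\ldots,x_n\rangle=\langle b_1,\ldots,b_n\rangle\ \mathtt{in}\ M$ reduces (in zero or more steps of the small-step relation $\to$) to $\langle c_1,\ldots,c_m\rangle$.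
   Context: **Language $\mathbf{PCF}^{\mathbf{list}}$.** Terms: $M,N,P::= x \mid \lambda x.M \mid MN \mid \langle M,N\rangle \mid \pi_1(M)\mid\pi_2(M)\mid \mathtt{skip}\mid \mathtt{let}\ \mathtt{skip}=M\ \mathtt{in}\ N \mid \mathtt{tt}\mid\mathtt{ff}\mid \mathtt{if}\ M\ \mathtt{then}\ N\ \mathtt{else}\ P \mid \mathtt{and}\mid\mathtt{xor}\mid\mathtt{not}\mid \mathtt{inj}_1(M)\mid\mathtt{inj}_2(M)\mid \mathtt{match}\ P\ \mathtt{with}\ (x\mapsto M\mid y\mapsto N)\mid \mathtt{split}\mid Y(M)\mid \mathtt{Err}$. Types: $A,B::=\mathtt{bit}\mid A\oplus B\mid A\times B\mid \mathbf 1\mid A\to B\mid [A]$. Typing rules (context $\Delta$): $\Delta,x:A\vdash x:A$; $\mathtt{tt},\mathtt{ff}:\mathtt{bit}$; $\mathtt{skip}:\mathbf 1$; $\mathtt{Err}:A$ for any $A$; $\mathtt{not}:\mathtt{bit}\to\mathtt{bit}$; $\mathtt{and},\mathtt{xor}:\mathtt{bit}\times\mathtt{bit}\to\mathtt{bit}$; $\mathtt{split}:[A]\to\mathbf 1\oplus(A\times[A])$; the usual rules for $\lambda$, application, pairs, projections, injections, $\mathtt{let}\ \mathtt{skip}$ (first argument of type $\mathbf 1$), and $\mathtt{match}$ (on $P:A\oplus B$, branches typed with $x:A$ resp. $y:B$); if $\Delta\vdash M:\mathbf 1\oplus(A\times[A])$ then $\Delta\vdash M:[A]$; if $\Delta\vdash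 M:A\to A$ then $\Delta\vdash Y(M):A$; $\mathtt{if}\ P\ \mathtt{then}\ M\ \mathtt{else}\ N : C$ when $P:\mathtt{bit}$, $M,N:C$ and $C$ is first-order, i.e. generated by $C::=\mathtt{bit}\mid C\times C\mid [C]$. Notation: $\mathtt{nil}=\mathtt{inj}_1(\mathtt{skip})$, $M::N=\mathtt{inj}_2\langle M,N\rangle$, $[M_1,\ldots,M_n]=M_1::(\cdots::(M_n::\mathtt{nil}))$, $\langle M_1,\ldots,M_n\rangle=\langle M_1,\langle\ldots,M_n\rangle\rangle$ with the corresponding $n$-ary projections $\pi_i$; $\mathtt{bit}^m$ is the $m$-fold (right-nested) product of $\mathtt{bit}$; $\mathtt{let}\ x=N\ \mathtt{in}\ M$ is $(\lambda x.M)N$; $\mathtt{let}\ \langle x_1,\ldots,x_n\rangle=N\ \mathtt{in}\ M$ is $\mathtt{let}\ z=N\ \mathtt{in}\ \mathtt{let}\ x_1=\pi_1(z)\ \mathtt{in}\cdots\mathtt{let}\ x_n=\pi_n(z)\ \mathtt{in}\ M$ with $z$ fresh. **Small-step semantics $\to$:** the smallest relation closed under arbitrary subterm contexts containing $(\lambda x.M)N\to M[N/x]$; $\pi_i\langle M_1,M_2\rangle\to M_i$; $\mathtt{let}\ \mathtt{skip}=\mathtt{skip}\ \mathtt{in}\ M\to M$; $\mathtt{if}\ \mathtt{tt}\ \mathtt{then}\ M\ \mathtt{else}\ N\to M$; $\mathtt{if}\ \mathtt{ff}\ \mathtt{then}\ M\ \mathtt{else}\ N\to N$; $\mathtt{split}\,M\to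 M$; $\mathtt{match}\ \mathtt{inj}_i(P)\ \mathtt{with}\ (x_1\mapsto M_1\mid x_2\mapsto M_2)\to M_i[P/x_i]$; $Y(M)\to M(Y(M))$; and the evident rules computing $\mathtt{not},\mathtt{and},\mathtt{xor}$ on the constants $\mathtt{tt},\mathtt{ff}$ (e.g. $\mathtt{not}\ \mathtt{tt}\to\mathtt{ff}$). $\mathtt{Err}$ does not reduce. **Reversible circuits.** A gate is $\mathrm{cnot}_i(b_1^{j_1}\ldots b_r^{j_r})$ with $i,j_1,\ldots,j_r$ natural numbers, $i\neq j_k$, $b_k$ booleans (written $\mathrm{not}_i$ if $r=0$); its wires are $\{i,j_1,\ldots,j_r\}$; $\mathrm{wires}(C)$ is the union of the wires of the gates of a list $C$. A circuit is $(I,C,O)$ with $C$ a list of gates and $I,O$ sets of wires. Executing gate $\mathrm{cnot}_i(b_1^{j_1}\ldots b_r^{j_r})$ on a valuation $v$ (a boolean per wire) gives $w$ with $w_l=v_l$ for $l\neq i$ and $w_i=v_i\ \mathtt{xor}\ \bigwedge_{k}(v_{j_k}\ \mathtt{xor}\ b_k\ \mathtt{xor}\ \mathtt{tt})$ (and $w_i=\mathtt{not}(v_i)$ if $r=0$). Executing $(I,C,O)$ on inputs $(x_i)_{i\in I}$: initialize $v_k=x_k$ for $k\in I$ and $v_k=\mathtt{ff}$ for all other wires, execute the gates of $C$ in reverse list order, and return $(v_k)_{k\in O}$. **Abstract machines.** A circuit-generating abstract machine is a triple $(M,(I,C),L)$ where $p_1:\mathtt{bit},\ldots,p_{n+k}:\mathtt{bit}\vdash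 M:\mathtt{bit}^m$, $I=\{1,\ldots,n\}$, $C$ is a list of gates, and $L$ is a one-to-one map from the free variables of $M$ onto wires in $\mathrm{wires}(C)\cup I$. For $x_1:\mathtt{bit},\ldots,x_n:\mathtt{bit}\vdash M:\mathtt{bit}^m$, $\mathit{EmptyAM}(M)=(M,(\{1,\ldots,n\},[\,]),\{x_i\mapsto i\})$. A first-order extension of $L$ is a term built from variables of the domain of $L$ by tuples $\langle\ldots\rangle$ and list literals $[\ldots]$; two such have the same shape if both are tuples of the same size or both lists of the same length with componentwise same shape (variables having the same shape). Beta-contexts $E[-]$ are one-hole contexts whose hole may be in any immediate subterm position of any term constructor (under $\lambda$, either side of application, pairs, projections, $\mathtt{let}\ \mathtt{skip}$, any of the three arguments of $\mathtt{if}$, injections, any of the three parts of $\mathtt{match}$, $Y$). The relation $\to_{am}$ is: $(E[R],RC,L)\to_{am}(E[R'],RC,L)$ for each of the rules $(\lambda x.M)N\mapsto M[N/x]$, $\pi_i\langle M_1,M_2\rangle\mapsto M_i$, $\mathtt{let}\ \mathtt{skip}=\mathtt{skip}\ \mathtt{in}\ M\mapsto M$, $\mathtt{split}\,M\mapsto M$, $\mathtt{match}\ \mathtt{inj}_i(P)\ldots\mapsto M_i[P/x_i]$, $Y(M)\mapsto M(Y(M))$; and the boolean rules, where $i_0$ is a new wire, $p_{i_0}$ a fresh variable, $L'=L\cup\{p_{i_0}\mapsto i_0\}$, and $G::(I,C)$ means $(I,G::C)$: $(E[\mathtt{ff}],RC,L)\to_{am}(E[p_{i_0}],RC,L')$;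 $(E[\mathtt{tt}],RC,L)\to_{am}(E[p_{i_0}],\mathrm{not}_{i_0}::RC,L')$; $(E[\mathtt{not}\ p_i],RC,L)\to_{am}(E[p_{i_0}],\mathrm{cnot}_{i_0}(\mathtt{ff}^{L(p_i)})::RC,L')$; $(E[\mathtt{and}\ p_i\ p_j],RC,L)\to_{am}(E[p_{i_0}],\mathrm{cnot}_{i_0}(\mathtt{tt}^{L(p_i)}\mathtt{tt}^{L(p_j)})::RC,L')$; $(E[\mathtt{xor}\ p_i\ p_j],RC,L)\to_{am}(E[p_{i_0}],\mathrm{cnot}_{i_0}(\mathtt{tt}^{L(p_i)})::\mathrm{cnot}_{i_0}(\mathtt{tt}^{L(p_j)})::RC,L')$; and for first-order extensions $V,W$ of $L$: if $V,W$ have the same shape, $(E[\mathtt{if}\ p_i\ \mathtt{then}\ V\ \mathtt{else}\ W],RC,L)\to_{am}(E[U],RC',L'')$ where $U$ has the same shape, its variables $u_1,\ldots,u_r$ are fresh, pairwise distinct and mapped by $L''\supseteq L$ to new distinct wires, and, writing $v_1,\ldots,v_r$ and $w_1,\ldots,w_r$ for the corresponding variables of $V$ and $W$, $RC'$ is $RC$ with the gates $\mathrm{cnot}_{u_j}(\mathtt{tt}^{p_i}\mathtt{tt}^{v_j})$ and $\mathrm{cnot}_{u_j}(\mathtt{ff}^{p_i}\mathtt{tt}^{w_j})$ added (variables standing for their wires); otherwise it steps to $E[\mathtt{Err}]$. **Readback.** For a machine $(M,(I,C),L)$ and $\vec u=(u_i)_{i\in I}$, let $v$ be the final valuation of executing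 the circuit $(I,C,\mathrm{Range}(L))$ on $\vec u$; $T(M,(I,C),L)(\vec u)$ is $M$ with each free variable $x$ replaced by the boolean constant $v_{L(x)}$. *)

(* Defs.v *)
From mathcomp Require Import all_boot.
Set Implicit Arguments. Unset Strict Implicit. Unset Printing Implicit Defensive.

Inductive ty :=
| TBit | TSum (A B : ty) | TProd (A B : ty) | TUnit | TArrow (A B : ty) | TList (A : ty).

Fixpoint fo_ty (A : ty) : bool :=
  match A with
  | TBit => true
  | TProd A B => fo_ty A && fo_ty B
  | TList A => fo_ty A
  | _ => false
  end.

Fixpoint bitn (m : nat) : ty :=
  match m with
  | 0 => TUnit
  | 1 => TBit
  | m'.+1 => TProd TBit (bitn m')
  end.

(* Terms: bound variables are de Bruijn indices (BVar), free variables
   are names (FVar).  Lam binds one variable in its body, Match binds one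
   variable in each branch.  `and`, `xor` : bit x bit -> bit and `not`,
   `split` are constants. *)
Inductive term :=
| BVar (k : nat) | FVar (x : nat)
| Lam (M : term) | App (M N : term)
| Pair (M N : term) | Proj1 (M : term) | Proj2 (M : term)
| Skip | LetSkip (M N : term)
| TT | FF | If (P M N : term)
| And | Xor | Not
| Inj1 (M : term) | Inj2 (M : term) | Match (P M N : term)
| Split | Y (M : term) | Err.

Fixpoint shift (c : nat) (M : term) : term :=
  match M with
  | BVar k => BVar (if c <= k then k.+1 else k)
  | FVar x => FVar x
  | Lam M => Lam (shift c.+1 M)
  | App M N => App (shift c M) (shift c N)
  | Pair M N => Pair (shift c M) (shift c N)
  | Proj1 M => Proj1 (shift c M)
  | Proj2 M => Proj2 (shift c M)
  | Skip => Skip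
  | LetSkip M N => LetSkip (shift c M) (shift c N)
  | TT => TT | FF => FF
  | If P M N => If (shift c P) (shift c M) (shift c N)
  | And => And | Xor => Xor | Not => Not
  | Inj1 M => Inj1 (shift c M)
  | Inj2 M => Inj2 (shift c M)
  | Match P M N => Match (shift c P) (shift c.+1 M) (shift c.+1 N)
  | Split => Split
  | Y M => Y (shift c M)
  | Err => Err
  end.

Fixpoint subst (k : nat) (N : term) (M : term) : term :=
  match M with
  | BVar i => if i == k then N else if k < i then BVar i.-1 else BVar i
  | FVar x => FVar x
  | Lam M => Lam (subst k.+1 (shift 0 N) M)
  | App M1 M2 => App (subst k N M1) (subst k N M2)
  | Pair M1 M2 => Pair (subst k N M1) (subst k N M2)
  | Proj1 M => Proj1 (subst k N M)
  | Proj2 M => Proj2 (subst k N M)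
  | Skip => Skip
  | LetSkip M1 M2 => LetSkip (subst k N M1) (subst k N M2)
  | TT => TT | FF => FF
  | If P M1 M2 => If (subst k N P) (subst k N M1) (subst k N M2)
  | And => And | Xor => Xor | Not => Not
  | Inj1 M => Inj1 (subst k N M)
  | Inj2 M => Inj2 (subst k N M)
  | Match P M1 M2 =>
      Match (subst k N P) (subst k.+1 (shift 0 N) M1) (subst k.+1 (shift 0 N) M2)
  | Split => Split
  | Y M => Y (subst k N M)
  | Err => Err
  end.

Fixpoint fv (M : term) : seq nat :=
  match M with
  | BVar _ => [::]
  | FVar x => [:: x]
  | Lam M | Proj1 M | Proj2 M | Inj1 M | Inj2 M | Y M => fv M
  | App M N | Pair M N | LetSkip M N => fv M ++ fv N
  | If P M N | Match P M N => fv P ++ fv M ++ fv N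
  | _ => [::]
  end.

Fixpoint close (k : nat) (x : nat) (M : term) : term :=
  match M with
  | BVar i => BVar i
  | FVar y => if y == x then BVar k else FVar y
  | Lam M => Lam (close k.+1 x M)
  | App M N => App (close k x M) (close k x N)
  | Pair M N => Pair (close k x M) (close k x N)
  | Proj1 M => Proj1 (close k x M)
  | Proj2 M => Proj2 (close k x M)
  | Skip => Skip
  | LetSkip M N => LetSkip (close k x M) (close k x N)
  | TT => TT | FF => FF
  | If P M N => If (close k x P) (close k x M) (close k x N)
  | And => And | Xor => Xor | Not => Not
  | Inj1 M => Inj1 (close k x M)
  | Inj2 M => Inj2 (close k x M)
  | Match P M N => Match (close k x P) (close k.+1 x M) (close k.+1 x N)
  | Split => Split
  | Y M => Y (close k x M)
  | Err => Err
  end.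

Definition lam (x : nat) (M : term) : term := Lam (close 0 x M).
Definition let_in (x : nat) (N M : term) : term := App (lam x M) N.

Definition bconst (b : bool) : term := if b then TT else FF.

Fixpoint tup (Ms : seq term) : term :=
  match Ms with
  | [::] => Skip
  | [:: M] => M
  | M :: Ms' => Pair M (tup Ms')
  end.

(* n-ary projection pi_i (1 <= i <= n) for n-tuples *)
Definition nproj (n i : nat) (z : term) : term :=
  let t := iter i.-1 Proj2 z in if i == n then t else Proj1 t.

Definition fresh_name (s : seq nat) : nat := (foldr maxn 0 s).+1.

Definition let_tuple (xs : seq nat) (N M : term) : term :=
  let n := size xs in
  let z := fresh_name (xs ++ fv M) in
  let_in z N
    (foldr (fun ix body => let_in ix.2 (nproj n ix.1 (FVar z)) body) M
       (zip (iota 1 n) xs)).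

(* Typing  D ; G |- M : A  (D: named context, G: context of the de Bruijn
   bound variables, index 0 = innermost binder) *)
Inductive has_type (D : nat -> option ty) : seq ty -> term -> ty -> Prop :=
| ty_fvar G x A : D x = Some A -> has_type D G (FVar x) A
| ty_bvar G k : k < size G -> has_type D G (BVar k) (nth TUnit G k)
| ty_lam G M A B : has_type D (A :: G) M B -> has_type D G (Lam M) (TArrow A B)
| ty_app G M N A B :
    has_type D G M (TArrow A B) -> has_type D G N A -> has_type D G (App M N) B
| ty_pair G M N A B :
    has_type D G M A -> has_type D G N B -> has_type D G (Pair M N) (TProd A B)
| ty_proj1 G M A B : has_type D G M (TProd A B) -> has_type D G (Proj1 M) A
| ty_proj2 G M A B : has_type D G M (TProd A B) -> has_type D G (Proj2 M) B
| ty_skip G : has_type D G Skip TUnit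
| ty_letskip G M N A :
    has_type D G M TUnit -> has_type D G N A -> has_type D G (LetSkip M N) A
| ty_tt G : has_type D G TT TBit
| ty_ff G : has_type D G FF TBit
| ty_if G P M N C :
    has_type D G P TBit -> has_type D G M C -> has_type D G N C -> fo_ty C ->
    has_type D G (If P M N) C
| ty_and G : has_type D G And (TArrow (TProd TBit TBit) TBit)
| ty_xor G : has_type D G Xor (TArrow (TProd TBit TBit) TBit)
| ty_not G : has_type D G Not (TArrow TBit TBit)
| ty_inj1 G M A B : has_type D G M A -> has_type D G (Inj1 M) (TSum A B)
| ty_inj2 G M A B : has_type D G M B -> has_type D G (Inj2 M) (TSum A B)
| ty_match G P M N A B C :
    has_type D G P (TSum A B) -> has_type D (A :: G) M C -> has_type D (B :: G) N C ->
    has_type D G (Match P M N) C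
| ty_split G A :
    has_type D G Split (TArrow (TList A) (TSum TUnit (TProd A (TList A))))
| ty_fold G M A :
    has_type D G M (TSum TUnit (TProd A (TList A))) -> has_type D G M (TList A)
| ty_Y G M A : has_type D G M (TArrow A A) -> has_type D G (Y M) A
| ty_err G A : has_type D G Err A.

Definition bit_ctx (xs : seq nat) : nat -> option ty :=
  fun x => if x \in xs then Some TBit else None.

Inductive ctx :=
| Hole
| CLam (E : ctx)
| CAppL (E : ctx) (N : term) | CAppR (M : term) (E : ctx)
| CPairL (E : ctx) (N : term) | CPairR (M : term) (E : ctx)
| CProj1 (E : ctx) | CProj2 (E : ctx)
| CLetSkipL (E : ctx) (N : term) | CLetSkipR (M : term) (E : ctx)
| CIf1 (E : ctx) (M N : term) | CIf2 (P : term) (E : ctx) (N : term)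
| CIf3 (P M : term) (E : ctx)
| CInj1 (E : ctx) | CInj2 (E : ctx)
| CMatch1 (E : ctx) (M N : term) | CMatch2 (P : term) (E : ctx) (N : term)
| CMatch3 (P M : term) (E : ctx)
| CY (E : ctx).

Fixpoint plug (E : ctx) (R : term) : term :=
  match E with
  | Hole => R
  | CLam E => Lam (plug E R)
  | CAppL E N => App (plug E R) N
  | CAppR M E => App M (plug E R)
  | CPairL E N => Pair (plug E R) N
  | CPairR M E => Pair M (plug E R)
  | CProj1 E => Proj1 (plug E R)
  | CProj2 E => Proj2 (plug E R)
  | CLetSkipL E N => LetSkip (plug E R) N
  | CLetSkipR M E => LetSkip M (plug E R)
  | CIf1 E M N => If (plug E R) M N
  | CIf2 P E N => If P (plug E R) N
  | CIf3 P M E => If P M (plug E R)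
  | CInj1 E => Inj1 (plug E R)
  | CInj2 E => Inj2 (plug E R)
  | CMatch1 E M N => Match (plug E R) M N
  | CMatch2 P E N => Match P (plug E R) N
  | CMatch3 P M E => Match P M (plug E R)
  | CY E => Y (plug E R)
  end.

Inductive head_pure : term -> term -> Prop :=
| hp_beta M N : head_pure (App (Lam M) N) (subst 0 N M)
| hp_proj1 M N : head_pure (Proj1 (Pair M N)) M
| hp_proj2 M N : head_pure (Proj2 (Pair M N)) N
| hp_letskip M : head_pure (LetSkip Skip M) M
| hp_split M : head_pure (App Split M) M
| hp_match1 P M N : head_pure (Match (Inj1 P) M N) (subst 0 P M)
| hp_match2 P M N : head_pure (Match (Inj2 P) M N) (subst 0 P N)
| hp_Y M : head_pure (Y M) (App M (Y M)).

Inductive head_step : term -> term -> Prop :=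
| hs_pure R R' : head_pure R R' -> head_step R R'
| hs_iftt M N : head_step (If TT M N) M
| hs_ifff M N : head_step (If FF M N) N
| hs_not b : head_step (App Not (bconst b)) (bconst (~~ b))
| hs_and b1 b2 :
    head_step (App And (Pair (bconst b1) (bconst b2))) (bconst (b1 && b2))
| hs_xor b1 b2 :
    head_step (App Xor (Pair (bconst b1) (bconst b2))) (bconst (b1 (+) b2)).

Inductive step : term -> term -> Prop :=
| step_ctx E R R' : head_step R R' -> step (plug E R) (plug E R').

Inductive star (T : Type) (r : T -> T -> Prop) : T -> T -> Prop :=
| star_refl a : star r a a
| star_step a b c : r a b -> star r b c -> star r a c.

(* Reversible circuits.  The gate cnot_i(b1^j1 ... br^jr) is
   Gate i [:: (b1, j1); ...; (br, jr)]; not_i is Gate i [::]. *)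
Record gate := Gate { target : nat; controls : seq (bool * nat) }.

Definition gate_wires (g : gate) : seq nat := target g :: map snd (controls g).
Definition wires (C : seq gate) : seq nat := flatten (map gate_wires C).

Definition exec_gate (g : gate) (v : nat -> bool) : nat -> bool :=
  fun l => if l == target g
           then v l (+) all (fun c => v c.2 (+) c.1 (+) true) (controls g)
           else v l.

(* final valuation of executing (I, C, _) on inputs u (only u i for i in I
   is used); the gates of C are executed in reverse list order *)
Definition exec_circuit (I : seq nat) (C : seq gate) (u : nat -> bool) : nat -> bool :=
  foldr exec_gate (fun k => if k \in I then u k else false) C.

(* Abstract machines (M, (I, C), L); L is a partial map variables -> wires *)
Record am := AM { am_term : term; am_I : seq nat; am_C : seq gate;
                  am_L : nat -> option nat }.

Definition EmptyAM (xs : seq nat) (M : term) : am :=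
  AM M (iota 1 (size xs)) [::]
     (fun y => if y \in xs then Some (index y xs).+1 else None).

Definition new_wire (I : seq nat) (C : seq gate) (L : nat -> option nat) (w : nat) :=
  w \notin I /\ w \notin wires C /\ (forall y, L y <> Some w).

Definition fresh_var (L : nat -> option nat) (M : term) (p : nat) :=
  L p = None /\ p \notin fv M.

Definition extL (L : nat -> option nat) (p w : nat) : nat -> option nat :=
  fun y => if y == p then Some w else L y.

Inductive fot := FOVar (x : nat) | FOPair (V W : fot) | FOList (Vs : seq fot).

Fixpoint fot_term (V : fot) : term :=
  match V with
  | FOVar x => FVar x
  | FOPair V W => Pair (fot_term V) (fot_term W)
  | FOList Vs => foldr (fun V t => Inj2 (Pair (fot_term V) t)) (Inj1 Skip) Vs
  end.

Fixpoint fot_vars (V : fot) : seq nat :=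
  match V with
  | FOVar x => [:: x]
  | FOPair V W => fot_vars V ++ fot_vars W
  | FOList Vs => flatten (map fot_vars Vs)
  end.

(* the shape: all variables erased; same shape <-> equal erasures *)
Fixpoint fot_shape (V : fot) : fot :=
  match V with
  | FOVar _ => FOVar 0
  | FOPair V W => FOPair (fot_shape V) (fot_shape W)
  | FOList Vs => FOList (map fot_shape Vs)
  end.

Definition fo_ext (L : nat -> option nat) (V : fot) : Prop :=
  forall x, x \in fot_vars V -> L x <> None.

Definition wire_of (L : nat -> option nat) (x : nat) : nat := odflt 0 (L x).

Definition if_gates (L : nat -> option nat) (wp : nat)
    (us vs ws : seq nat) : seq gate :=
  flatten [seq [:: Gate t.1 [:: (true, wp); (true, wire_of L t.2.1)];
                   Gate t.1 [:: (false, wp); (true, wire_of L t.2.2)]]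
          | t <- zip us (zip vs ws)].

Inductive am_step : am -> am -> Prop :=
| am_pure E R R' I C L :
    head_pure R R' -> am_step (AM (plug E R) I C L) (AM (plug E R') I C L)
| am_ff E I C L p i0 :
    fresh_var L (plug E FF) p -> new_wire I C L i0 ->
    am_step (AM (plug E FF) I C L) (AM (plug E (FVar p)) I C (extL L p i0))
| am_tt E I C L p i0 :
    fresh_var L (plug E TT) p -> new_wire I C L i0 ->
    am_step (AM (plug E TT) I C L)
            (AM (plug E (FVar p)) I (Gate i0 [::] :: C) (extL L p i0))
| am_not E I C L q wq p i0 :
    L q = Some wq ->
    fresh_var L (plug E (App Not (FVar q))) p -> new_wire I C L i0 ->
    am_step (AM (plug E (App Not (FVar q))) I C L)
            (AM (plug E (FVar p)) I (Gate i0 [:: (false, wq)] :: C) (extL L p i0))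
| am_and E I C L q1 q2 w1 w2 p i0 :
    L q1 = Some w1 -> L q2 = Some w2 ->
    fresh_var L (plug E (App And (Pair (FVar q1) (FVar q2)))) p ->
    new_wire I C L i0 ->
    am_step (AM (plug E (App And (Pair (FVar q1) (FVar q2)))) I C L)
            (AM (plug E (FVar p)) I (Gate i0 [:: (true, w1); (true, w2)] :: C)
                (extL L p i0))
| am_xor E I C L q1 q2 w1 w2 p i0 :
    L q1 = Some w1 -> L q2 = Some w2 ->
    fresh_var L (plug E (App Xor (Pair (FVar q1) (FVar q2)))) p ->
    new_wire I C L i0 ->
    am_step (AM (plug E (App Xor (Pair (FVar q1) (FVar q2)))) I C L)
            (AM (plug E (FVar p)) I
                (Gate i0 [:: (true, w1)] :: Gate i0 [:: (true, w2)] :: C)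
                (extL L p i0))
| am_if E I C L q wq V W U ws :
    L q = Some wq -> fo_ext L V -> fo_ext L W ->
    fot_shape V = fot_shape W -> fot_shape U = fot_shape V ->
    uniq (fot_vars U) ->
    (forall u, u \in fot_vars U ->
       fresh_var L (plug E (If (FVar q) (fot_term V) (fot_term W))) u) ->
    size ws = size (fot_vars U) -> uniq ws ->
    (forall w, w \in ws -> new_wire I C L w) ->
    am_step (AM (plug E (If (FVar q) (fot_term V) (fot_term W))) I C L)
            (AM (plug E (fot_term U)) I
                (if_gates L wq ws (fot_vars V) (fot_vars W) ++ C)
                (foldr (fun t L' => extL L' t.1 t.2) L (zip (fot_vars U) ws)))
| am_if_err E I C L q wq V W :
    L q = Some wq -> fo_ext L V -> fo_ext L W ->
    fot_shape V <> fot_shape W ->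
    am_step (AM (plug E (If (FVar q) (fot_term V) (fot_term W))) I C L)
            (AM (plug E Err) I C L).

Fixpoint fsubst_bool (f : nat -> option bool) (M : term) : term :=
  match M with
  | BVar i => BVar i
  | FVar y => match f y with Some b => bconst b | None => FVar y end
  | Lam M => Lam (fsubst_bool f M)
  | App M N => App (fsubst_bool f M) (fsubst_bool f N)
  | Pair M N => Pair (fsubst_bool f M) (fsubst_bool f N)
  | Proj1 M => Proj1 (fsubst_bool f M)
  | Proj2 M => Proj2 (fsubst_bool f M)
  | Skip => Skip
  | LetSkip M N => LetSkip (fsubst_bool f M) (fsubst_bool f N)
  | TT => TT | FF => FF
  | If P M N => If (fsubst_bool f P) (fsubst_bool f M) (fsubst_bool f N)
  | And => And | Xor => Xor | Not => Not
  | Inj1 M => Inj1 (fsubst_bool f M)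
  | Inj2 M => Inj2 (fsubst_bool f M)
  | Match P M N => Match (fsubst_bool f P) (fsubst_bool f M) (fsubst_bool f N)
  | Split => Split
  | Y M => Y (fsubst_bool f M)
  | Err => Err
  end.

Definition readback (S : am) (u : nat -> bool) : term :=
  let v := exec_circuit (am_I S) (am_C S) u in
  fsubst_bool (fun x => omap v (am_L S x)) (am_term S).

(* Main.v *)
Require Import Defs.
From mathcomp Require Import all_boot.
From mathcomp Require Import zify.
Import Defs.

(** Reading a machine state back along the final valuation of its circuit turns
    every machine step into a reduction of the term, because new gates only
    change new wires.  The exception is a conditional with branches of different
    shapes, which the machine replaces by [Err]; up to the order in which [Err]
    lies below every term, which reduction preserves, the simulation still holds.
    A tuple of booleans is maximal for this order, so the source program reduces
    to the final readback; confluence makes this the only tuple it reduces to,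
    and subject reduction fixes its length. *)

Set Implicit Arguments. Unset Strict Implicit. Unset Printing Implicit Defensive.

(** The machine does not know the bit it tests, so a conditional must merge both branches, and lists
    of different lengths cannot be merged; the program, run on concrete inputs, just picks one
    branch. Hence the invariant of a run is not that the initial readback reduces to the current
    one, but that it reduces to some term above it. No redex contains [Err], so a larger term can
    follow every reduction of a smaller one. Reduction is handled throughout as parallel reduction:
    it is closed under contexts and substitution, a machine step other than the one to [Err] reads
    back as a single parallel step, and its confluence requires neither types nor termination, which
    [Y] excludes. Inputs are names while binders are indices. Readback and the contraction of the
    tuple binding are both treated as substitution of closed terms for names, so program and initial
    state meet in one term: [M] with its inputs replaced by constants. *)

Ltac inv H := inversion H; clear H; subst.

(** * Reflexive-transitive closures *)

Lemma star1 (T : Type) (r : T -> T -> Prop) a b : r a b -> star r a b.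
Proof. by move=> h; apply: star_step h (star_refl _ _). Qed.

Lemma star_trans (T : Type) (r : T -> T -> Prop) a b c :
  star r a b -> star r b c -> star r a c.
Proof. by elim=> // x y z xy _ IH /IH; apply: star_step. Qed.

Lemma star_map (T U : Type) (r : T -> T -> Prop) (s : U -> U -> Prop) (f : T -> U) :
  (forall a b, r a b -> star s (f a) (f b)) ->
  forall a b, star r a b -> star s (f a) (f b).
Proof.
move=> h a b; elim=> [x|x y z xy _]; first exact: star_refl.
exact: star_trans (h _ _ xy).
Qed.

(** * Substitution calculus *)

Lemma shift_shift c d M : c <= d -> shift c (shift d M) = shift d.+1 (shift c M).
Proof.
elim: M c d => //=; try by (move=> *; f_equal; auto).
move=> k c d h; f_equal.
by case: (leqP d k) => ?; case: (leqP c k) => ?; repeat (case: ifP => ?); lia.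
Qed.

Lemma subst_shift k N M : subst k N (shift k M) = M.
Proof.
elim: M k N => //=; try by (move=> *; f_equal; auto).
by move=> i k N; case: (leqP k i) => h; repeat (case: ifP => ?) => //; lia.
Qed.

Lemma shift_subst_ge c k N M : c <= k ->
  shift c (subst k N M) = subst k.+1 (shift c N) (shift c M).
Proof.
elim: M c k N => //=;
  try by (move=> *; f_equal; rewrite ?(@shift_shift 0) //; auto).
move=> i c k N h; case: (i =P k) => [->|ik].
  by rewrite h eqxx.
case: (ltnP k i) => ki /=.
  have -> : c <= i by lia.
  have -> : c <= i.-1 by lia.
  by repeat (case: ifP => ?); try lia; congr BVar; lia.
by case: (leqP c i) => ci; repeat (case: ifP => ?); try lia; congr BVar; lia.
Qed.

Lemma shift_subst_le c k N M : k <= c ->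
  shift c (subst k N M) = subst k (shift c N) (shift c.+1 M).
Proof.
elim: M c k N => //=;
  try by (move=> *; f_equal; rewrite ?(@shift_shift 0) //; auto).
move=> i c k N h; case: (i =P k) => [->|ik].
  by rewrite ltnNge h /= eqxx.
by case: (ltnP k i) => ki /=; case: (ltnP c i) => ci /=;
  repeat (case: ifP => ?); try lia; congr BVar; lia.
Qed.

(** The substitution lemma of the lambda calculus for indices; it lets parallel reduction commute
    with substitution at every rule that substitutes. *)
Lemma subst_subst j k N P M : j <= k ->
  subst k N (subst j P M) = subst j (subst k N P) (subst k.+1 (shift j N) M).
Proof.
elim: M j k N P => //=;
  try by (move=> *; f_equal;
          rewrite ?(@shift_shift 0) ?(@shift_subst_ge 0) //; auto).
move=> i j k N P h; case: (i =P j) => [->|ij].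
  have -> : (j == k.+1) = false by lia.
  have -> : (k.+1 < j) = false by lia.
  by rewrite /= eqxx.
case: (i =P k.+1) => [->|ik].
  by rewrite ltnS h /= eqxx subst_shift.
case: (ltnP j i) => ji; case: (ltnP k.+1 i) => ki /=;
  repeat (case: ifP => ? /=); try lia; congr BVar; lia.
Qed.

(** * Local closure and substitution by name *)

Fixpoint lc (k : nat) (M : term) : bool :=
  match M with
  | BVar i => i < k
  | Lam M => lc k.+1 M
  | Proj1 M | Proj2 M | Inj1 M | Inj2 M | Y M => lc k M
  | App M N | Pair M N | LetSkip M N => lc k M && lc k N
  | If P M N => [&& lc k P, lc k M & lc k N]
  | Match P M N => [&& lc k P, lc k.+1 M & lc k.+1 N]
  | _ => true
  end.

Ltac split_andb :=
  repeat match goal with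
  | |- is_true (_ && _) -> _ => case/andP
  | H : is_true (_ && _) |- _ => case/andP: H => ? ?
  end.

Lemma shift_lc k c M : lc k M -> k <= c -> shift c M = M.
Proof.
elim: M k c => //=; try by (move=> *; split_andb; f_equal; eauto).
by move=> i k c ? ?; case: ifP => // ?; lia.
Qed.

Lemma lc_leq j k M : lc j M -> j <= k -> lc k M.
Proof.
elim: M j k => //=;
  try by (move=> *; split_andb; repeat (apply/andP; split); eauto).
by move=> *; lia.
Qed.

Lemma has_type_lc D G M A : has_type D G M A -> lc (size G) M.
Proof. by elim=> //= *; repeat (apply/andP; split). Qed.

Lemma lc_close j k x M : lc k M -> j <= k -> lc k.+1 (close j x M).
Proof.
elim: M j k => //=; try by (move=> *; split_andb; repeat (apply/andP; split); auto).
by move=> y j k *; case: ifP => //= _; lia.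
Qed.

Lemma close_notin k x M : x \notin fv M -> close k x M = M.
Proof.
elim: M k => //=;
  try by (move=> *; repeat match goal with
          | H : is_true (_ \notin _ ++ _) |- _ =>
            move: H; rewrite mem_cat negb_or => /andP[? ?] end; f_equal; auto).
by move=> y k; rewrite inE eq_sym => /negbTE ->.
Qed.

(* Named substitution without shifting: the images must be closed. *)
Fixpoint nsubst (f : nat -> option term) (M : term) : term :=
  match M with
  | BVar i => BVar i
  | FVar y => odflt (FVar y) (f y)
  | Lam M => Lam (nsubst f M)
  | App M N => App (nsubst f M) (nsubst f N)
  | Pair M N => Pair (nsubst f M) (nsubst f N)
  | Proj1 M => Proj1 (nsubst f M)
  | Proj2 M => Proj2 (nsubst f M)
  | Skip => Skip
  | LetSkip M N => LetSkip (nsubst f M) (nsubst f N)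
  | TT => TT | FF => FF
  | If P M N => If (nsubst f P) (nsubst f M) (nsubst f N)
  | And => And | Xor => Xor | Not => Not
  | Inj1 M => Inj1 (nsubst f M)
  | Inj2 M => Inj2 (nsubst f M)
  | Match P M N => Match (nsubst f P) (nsubst f M) (nsubst f N)
  | Split => Split
  | Y M => Y (nsubst f M)
  | Err => Err
  end.

Definition closed (N : term) : Prop := lc 0 N /\ fv N = [::].

Definition closed_images (f : nat -> option term) : Prop :=
  forall y N, f y = Some N -> closed N.

Definition single (x : nat) (N : term) : nat -> option term :=
  fun y => if y == x then Some N else None.

Lemma closed_single x N : closed N -> closed_images (single x N).
Proof. by move=> h y P; rewrite /single; case: ifP => // _ [<-]. Qed.

Lemma fsubst_boolE f M : fsubst_bool f M = nsubst (fun y => omap bconst (f y)) M.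
Proof.
elim: M => //=; try by (move=> *; f_equal; auto).
by move=> x; case: (f x).
Qed.

Lemma eq_nsubst f g M : {in fv M, f =1 g} -> nsubst f M = nsubst g M.
Proof.
elim: M => //=; try by (move=> *; f_equal;
  match goal with IH : _ -> ?a = ?b |- ?a = ?b =>
    apply: IH => y hy; match goal with H : {in _, _} |- _ =>
      apply: H; rewrite ?mem_cat hy ?orbT end end).
by move=> x h; rewrite (h x) ?inE.
Qed.

Lemma nsubst_none M : nsubst (fun _ => None) M = M.
Proof. by elim: M => //=; move=> *; f_equal. Qed.

Lemma nsubst_closed f M : fv M = [::] -> nsubst f M = M.
Proof. by move=> h; rewrite -[RHS]nsubst_none; apply: eq_nsubst; rewrite h. Qed.

Lemma lc_nsubst f k M : closed_images f -> lc k M -> lc k (nsubst f M).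
Proof.
move=> cf; elim: M k => //=;
  try by (move=> *; split_andb; repeat (apply/andP; split); auto).
move=> x k _; case E: (f x) => [N|] //=.
by apply: lc_leq (cf _ _ E).1 _.
Qed.

Lemma nsubst_shift f c M : closed_images f -> nsubst f (shift c M) = shift c (nsubst f M).
Proof.
move=> cf; elim: M c => //=; try by (move=> *; f_equal; auto).
move=> x c; case E: (f x) => [N|] //=.
by case: (cf _ _ E) => h _; rewrite (shift_lc h).
Qed.

Lemma subst_lc k j N M : lc j M -> j <= k -> subst k N M = M.
Proof.
elim: M k j N => //=; try by (move=> *; split_andb; f_equal; eauto).
by move=> i k j N ? ?; repeat (case: ifP => ? //); lia.
Qed.

Lemma nsubst_subst f k N M : closed_images f ->
  nsubst f (subst k N M) = subst k (nsubst f N) (nsubst f M).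
Proof.
move=> cf; elim: M k N => //=;
  try by (move=> *; f_equal; rewrite -?nsubst_shift //; auto).
- by move=> i k N; repeat case: ifP => //.
- move=> x k N; case E: (f x) => [P|] //=.
  by case: (cf _ _ E) => h _; rewrite (subst_lc _ h).
Qed.

(** Contracting a [let_in] is thereby a substitution by name, the form in which readback is
    expressed as well. *)
Lemma subst_close k x N M : lc k M -> closed N ->
  subst k N (close k x M) = nsubst (single x N) M.
Proof.
move=> + cN; elim: M k => //=;
  try by (move=> *; split_andb; f_equal; rewrite ?(shift_lc cN.1) //; auto).
- by move=> i k ik; repeat (case: ifP => ? //); lia.
- by move=> y k _; rewrite /single; case: ifP => //= _; rewrite eqxx.
Qed.

Lemma nsubst_close f k x M : closed_images f -> f x = None ->
  nsubst f (close k x M) = close k x (nsubst f M).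
Proof.
move=> cf fx; elim: M k => //=; try by (move=> *; f_equal; auto).
move=> y k; case: (y =P x) => [->|/eqP yx].
  by rewrite fx /= eqxx.
rewrite /=; case E: (f y) => [P|] /=; last by rewrite (negbTE yx).
by rewrite close_notin // (cf _ _ E).2.
Qed.

Lemma nsubst_nsubst f g M : closed_images g ->
  nsubst f (nsubst g M) = nsubst (fun y => if g y is Some N then Some N else f y) M.
Proof.
move=> cg; elim: M => //=; try by (move=> *; f_equal; auto).
move=> x; case E: (g x) => [N|] //=.
by rewrite nsubst_closed // (cg _ _ E).2.
Qed.

(** * Parallel reduction and confluence *)

(** Tait and Martin-Löf's parallel reduction: any set of redexes already present is contracted at
    once. This restores the diamond property, which single steps lack because contraction copies
    redexes. *)
Inductive par : term -> term -> Prop :=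
| p_bvar k : par (BVar k) (BVar k)
| p_fvar x : par (FVar x) (FVar x)
| p_lam M M' : par M M' -> par (Lam M) (Lam M')
| p_app M M' N N' : par M M' -> par N N' -> par (App M N) (App M' N')
| p_pair M M' N N' : par M M' -> par N N' -> par (Pair M N) (Pair M' N')
| p_proj1 M M' : par M M' -> par (Proj1 M) (Proj1 M')
| p_proj2 M M' : par M M' -> par (Proj2 M) (Proj2 M')
| p_skip : par Skip Skip
| p_letskip M M' N N' : par M M' -> par N N' -> par (LetSkip M N) (LetSkip M' N')
| p_tt : par TT TT
| p_ff : par FF FF
| p_if P P' M M' N N' :
    par P P' -> par M M' -> par N N' -> par (If P M N) (If P' M' N')
| p_and : par And And
| p_xor : par Xor Xor
| p_not : par Not Not
| p_inj1 M M' : par M M' -> par (Inj1 M) (Inj1 M')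
| p_inj2 M M' : par M M' -> par (Inj2 M) (Inj2 M')
| p_match P P' M M' N N' :
    par P P' -> par M M' -> par N N' -> par (Match P M N) (Match P' M' N')
| p_split : par Split Split
| p_Y M M' : par M M' -> par (Y M) (Y M')
| p_err : par Err Err
| r_beta M M' N N' : par M M' -> par N N' -> par (App (Lam M) N) (subst 0 N' M')
| r_proj1 M M' N : par M M' -> par (Proj1 (Pair M N)) M'
| r_proj2 M N N' : par N N' -> par (Proj2 (Pair M N)) N'
| r_letskip M M' : par M M' -> par (LetSkip Skip M) M'
| r_split M M' : par M M' -> par (App Split M) M'
| r_match1 P P' M M' N :
    par P P' -> par M M' -> par (Match (Inj1 P) M N) (subst 0 P' M')
| r_match2 P P' M N N' :
    par P P' -> par N N' -> par (Match (Inj2 P) M N) (subst 0 P' N')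
| r_Y M M' : par M M' -> par (Y M) (App M' (Y M'))
| r_iftt M M' N : par M M' -> par (If TT M N) M'
| r_ifff M N N' : par N N' -> par (If FF M N) N'
| r_not b : par (App Not (bconst b)) (bconst (~~ b))
| r_and b1 b2 : par (App And (Pair (bconst b1) (bconst b2))) (bconst (b1 && b2))
| r_xor b1 b2 : par (App Xor (Pair (bconst b1) (bconst b2))) (bconst (b1 (+) b2)).

#[local] Hint Constructors par : core.

Lemma par_refl M : par M M.
Proof. by elim: M; auto. Qed.

#[local] Hint Resolve par_refl : core.

Lemma shift_bconst c b : shift c (bconst b) = bconst b.
Proof. by case: b. Qed.

Lemma subst_bconst k N b : subst k N (bconst b) = bconst b.
Proof. by case: b. Qed.

Lemma par_shift c M M' : par M M' -> par (shift c M) (shift c M').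
Proof.
move=> h; elim: h c => /=; auto; try by (move=> *; rewrite ?shift_bconst; auto).
all: by move=> *; rewrite shift_subst_le //; auto.
Qed.

Lemma par_subst k M M' N N' : par M M' -> par N N' -> par (subst k N M) (subst k N' M').
Proof.
move=> h; elim: h k N N' => /=; try by (move=> *; rewrite ?subst_bconst; auto using par_shift).
- by move=> i k N N' h; case: ifP => // _; case: ifP.
all: by move=> *; rewrite (@subst_subst 0) //; auto using par_shift.
Qed.

Definition bval (M : term) : option bool :=
  match M with TT => Some true | FF => Some false | _ => None end.

Definition cd_bin (op : bool -> bool -> bool) (N D : term) : term :=
  match N with
  | Pair P Q =>
      match bval P, bval Q with
      | Some b, Some c => bconst (op b c)
      | _, _ => D
      end
  | _ => D
  end.

(** The undeveloped terms are passed along with their developments because redexes are recognised in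
    the source: one created by the development must stay uncontracted. *)
Definition cd_app (M N M' N' : term) : term :=
  match M, M' with
  | Lam _, Lam M1 => subst 0 N' M1
  | Split, _ => N'
  | Not, _ => if bval N is Some b then bconst (~~ b) else App M' N'
  | And, _ => cd_bin andb N (App M' N')
  | Xor, _ => cd_bin addb N (App M' N')
  | _, _ => App M' N'
  end.

Definition cd_proj1 (M M' : term) : term :=
  match M, M' with Pair _ _, Pair A _ => A | _, _ => Proj1 M' end.

Definition cd_proj2 (M M' : term) : term :=
  match M, M' with Pair _ _, Pair _ B => B | _, _ => Proj2 M' end.

Definition cd_match (P P' M' N' : term) : term :=
  match P, P' with
  | Inj1 _, Inj1 Q => subst 0 Q M'
  | Inj2 _, Inj2 Q => subst 0 Q N'
  | _, _ => Match P' M' N'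
  end.

(* Takahashi's complete development: all redexes of M contracted at once. *)
Fixpoint cd (M : term) : term :=
  match M with
  | Lam M => Lam (cd M)
  | App M N => cd_app M N (cd M) (cd N)
  | Pair M N => Pair (cd M) (cd N)
  | Proj1 M => cd_proj1 M (cd M)
  | Proj2 M => cd_proj2 M (cd M)
  | LetSkip M N => if M is Skip then cd N else LetSkip (cd M) (cd N)
  | If P M N =>
      match P with TT => cd M | FF => cd N | _ => If (cd P) (cd M) (cd N) end
  | Inj1 M => Inj1 (cd M)
  | Inj2 M => Inj2 (cd M)
  | Match P M N => cd_match P (cd P) (cd M) (cd N)
  | Y M => App (cd M) (Y (cd M))
  | _ => M
  end.

Lemma bvalP M b : bval M = Some b -> M = bconst b.
Proof. by case: M => //= -[<-]. Qed.

Lemma par_bconst b X : par (bconst b) X -> X = bconst b.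
Proof. by case: b => h; inv h. Qed.

Lemma cd_bin_par op R N N' D :
  (forall b c, par (App R (Pair (bconst b) (bconst c))) (bconst (op b c))) ->
  par N N' -> par (App R N') D -> par (App R N') (cd_bin op N D).
Proof.
move=> hop hN hD; case: N hN => //= P Q hN.
case hP: (bval P) => [b|] //; case hQ: (bval Q) => [c|] //.
rewrite (bvalP hP) (bvalP hQ) in hN; inv hN.
by rewrite (par_bconst H1) (par_bconst H3).
Qed.

Lemma cd_app_par M M' N N' : par M M' -> par M' (cd M) -> par N N' -> par N' (cd N) ->
  par (App M' N') (cd_app M N (cd M) (cd N)).
Proof.
move=> hM hM' hN hN'; case: M hM hM' => //=; try by auto.
- by move=> M1 h h'; inv h; inv h'; auto.
- by move=> h _; inv h; apply: cd_bin_par hN _; auto.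
- by move=> h _; inv h; apply: cd_bin_par hN _; auto.
- move=> h _; inv h; case E: (bval N) => [b|]; auto.
  by rewrite (bvalP E) in hN; rewrite (par_bconst hN).
- by move=> h _; inv h; auto.
Qed.

(** Takahashi's triangle: [cd M] contracts every redex of [M], so any partial choice of redexes can
    still be completed to it. It depends on [M] alone and therefore joins all parallel reducts. *)
Lemma par_cd M M' : par M M' -> par M' (cd M).
Proof.
elim=> //=; auto.
- by move=> *; apply: cd_app_par.
- move=> {M M'} M M' h h'; case: M h h' => //=; auto.
  by move=> P Q h h'; inv h; inv h'; auto.
- move=> {M M'} M M' h h'; case: M h h' => //=; auto.
  by move=> P Q h h'; inv h; inv h'; auto.
- by move=> {M M'} M M' N N' h h' k k'; case: M h h' => //=; auto; move=> h; inv h; auto.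
- by move=> P P' {M M'} M M' N N' h h' *; case: P h h' => //=; auto; move=> h; inv h; auto.
- move=> P P' {M M'} M M' N N' h h' *; case: P h h' => //=; auto.
  + by move=> P h h'; inv h; inv h'; auto.
  + by move=> P h h'; inv h; inv h'; auto.
- by move=> *; apply: par_subst.
- by move=> *; apply: par_subst.
- by move=> *; apply: par_subst.
- by case.
- by case=> [] [].
- by case=> [] [].
Qed.

Lemma par_strip M N P : par M N -> star par M P -> exists2 Q, star par N Q & par P Q.
Proof.
move=> hN h; elim: h N hN => [a|a b c ab _ IH] N hN; first by exists N => //; apply: star_refl.
have [Q bQ cQ] := IH _ (par_cd ab).
by exists Q => //; apply: star_step (par_cd hN) bQ.
Qed.

Lemma par_confluent M N P : star par M N -> star par M P ->
  exists2 Q, star par N Q & star par P Q.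
Proof.
move=> h; elim: h P => [a|a b c ab _ IH] P hP; first by exists P => //; apply: star_refl.
have [Q bQ PQ] := par_strip ab hP.
have [R cR QR] := IH _ bQ.
by exists R => //; apply: star_step PQ QR.
Qed.

(** * Agreement of parallel and small-step reduction *)

Fixpoint comp_ctx (E F : ctx) : ctx :=
  match E with
  | Hole => F
  | CLam E => CLam (comp_ctx E F)
  | CAppL E N => CAppL (comp_ctx E F) N
  | CAppR M E => CAppR M (comp_ctx E F)
  | CPairL E N => CPairL (comp_ctx E F) N
  | CPairR M E => CPairR M (comp_ctx E F)
  | CProj1 E => CProj1 (comp_ctx E F)
  | CProj2 E => CProj2 (comp_ctx E F)
  | CLetSkipL E N => CLetSkipL (comp_ctx E F) N
  | CLetSkipR M E => CLetSkipR M (comp_ctx E F)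
  | CIf1 E M N => CIf1 (comp_ctx E F) M N
  | CIf2 P E N => CIf2 P (comp_ctx E F) N
  | CIf3 P M E => CIf3 P M (comp_ctx E F)
  | CInj1 E => CInj1 (comp_ctx E F)
  | CInj2 E => CInj2 (comp_ctx E F)
  | CMatch1 E M N => CMatch1 (comp_ctx E F) M N
  | CMatch2 P E N => CMatch2 P (comp_ctx E F) N
  | CMatch3 P M E => CMatch3 P M (comp_ctx E F)
  | CY E => CY (comp_ctx E F)
  end.

Lemma plug_comp E F R : plug E (plug F R) = plug (comp_ctx E F) R.
Proof. by elim: E => //= *; f_equal. Qed.

Lemma star_step_plug E M N : star step M N -> star step (plug E M) (plug E N).
Proof.
apply: star_map => {}M {}N [F R R' h]; rewrite !plug_comp.
by apply: star1; constructor.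
Qed.

Lemma star_head M N P : head_step M N -> star step N P -> star step M P.
Proof. by move=> h; apply: star_step; apply: (@step_ctx Hole). Qed.

Lemma head_star M N P : star step M N -> head_step N P -> star step M P.
Proof. by move=> h k; apply: star_trans h (star_head k (star_refl _ _)). Qed.

(** With [step_par] this identifies the closures of [par] and [step], so everything up to the
    theorem can be stated for [par]. *)
Lemma par_star_step M N : par M N -> star step M N.
Proof.
have un E A A' : star step A A' -> star step (plug E A) (plug E A') := @star_step_plug E A A'.
have app A A' B B' : star step A A' -> star step B B' -> star step (App A B) (App A' B').
  move=> h k; apply: star_trans (un (CAppL Hole B) _ _ h) _.
  exact: (un (CAppR A' Hole)).
have pair A A' B B' : star step A A' -> star step B B' -> star step (Pair A B) (Pair A' B').
  move=> h k; apply: star_trans (un (CPairL Hole B) _ _ h) _.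
  exact: (un (CPairR A' Hole)).
have lets A A' B B' : star step A A' -> star step B B' -> star step (LetSkip A B) (LetSkip A' B').
  move=> h k; apply: star_trans (un (CLetSkipL Hole B) _ _ h) _.
  exact: (un (CLetSkipR A' Hole)).
have mtch Q Q' A A' B B' : star step Q Q' -> star step A A' -> star step B B' ->
    star step (Match Q A B) (Match Q' A' B').
  move=> h k l; apply: star_trans (un (CMatch1 Hole A B) _ _ h) _.
  apply: star_trans (un (CMatch2 Q' Hole B) _ _ k) _.
  exact: (un (CMatch3 Q' A' Hole)).
have ifs Q Q' A A' B B' : star step Q Q' -> star step A A' -> star step B B' ->
    star step (If Q A B) (If Q' A' B').
  move=> h k l; apply: star_trans (un (CIf1 Hole A B) _ _ h) _.
  apply: star_trans (un (CIf2 Q' Hole B) _ _ k) _.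
  exact: (un (CIf3 Q' A' Hole)).
elim=> /=; try (by move=> *; exact: star_refl); try (by auto).
- by move=> *; apply: (un (CLam Hole)).
- by move=> *; apply: (un (CProj1 Hole)).
- by move=> *; apply: (un (CProj2 Hole)).
- by move=> *; apply: (un (CInj1 Hole)).
- by move=> *; apply: (un (CInj2 Hole)).
- by move=> *; apply: (un (CY Hole)).
- move=> A A' B B' _ hA _ hB; apply: head_star (hs_pure (hp_beta _ _)).
  by apply: app => //; apply: (un (CLam Hole)).
- by move=> A A' B _ h; apply: star_head (hs_pure (hp_proj1 _ _)) h.
- by move=> A A' B _ h; apply: star_head (hs_pure (hp_proj2 _ _)) h.
- by move=> A A' _ h; apply: star_head (hs_pure (hp_letskip _)) h.
- by move=> A A' _ h; apply: star_head (hs_pure (hp_split _)) h.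
- move=> P P' A A' B _ hP _ hA; apply: head_star (hs_pure (hp_match1 _ _ B)).
  by apply: mtch => //; [apply: (un (CInj1 Hole))|apply: star_refl].
- move=> P P' A B B' _ hP _ hB; apply: head_star (hs_pure (hp_match2 _ A _)).
  by apply: mtch => //; [apply: (un (CInj2 Hole))|apply: star_refl].
- move=> A A' _ h; apply: star_head (hs_pure (hp_Y _)) _.
  by apply: app => //; apply: (un (CY Hole)).
- by move=> A A' B _ h; apply: star_head (hs_iftt _ _) h.
- by move=> A A' B _ h; apply: star_head (hs_ifff _ _) h.
- by move=> b; apply: star_head (hs_not _) (star_refl _ _).
- by move=> b c; apply: star_head (hs_and _ _) (star_refl _ _).
- by move=> b c; apply: star_head (hs_xor _ _) (star_refl _ _).
Qed.

Lemma par_plug E M N : par M N -> par (plug E M) (plug E N).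
Proof. by move=> h; elim: E => //=; auto. Qed.

Lemma head_pure_par M N : head_pure M N -> par M N.
Proof. by case; auto. Qed.

Lemma step_par M N : step M N -> par M N.
Proof.
case=> E R R' h; apply: par_plug; case: h => //; auto.
exact: head_pure_par.
Qed.

(** * Approximation by [Err] *)

(** The compatible order in which [Err] stands for the undefined term: going up replaces occurrences
    of [Err] by arbitrary terms. *)
Inductive ale : term -> term -> Prop :=
| a_err N : ale Err N
| a_bvar k : ale (BVar k) (BVar k)
| a_fvar x : ale (FVar x) (FVar x)
| a_lam M M' : ale M M' -> ale (Lam M) (Lam M')
| a_app M M' N N' : ale M M' -> ale N N' -> ale (App M N) (App M' N')
| a_pair M M' N N' : ale M M' -> ale N N' -> ale (Pair M N) (Pair M' N')
| a_proj1 M M' : ale M M' -> ale (Proj1 M) (Proj1 M')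
| a_proj2 M M' : ale M M' -> ale (Proj2 M) (Proj2 M')
| a_skip : ale Skip Skip
| a_letskip M M' N N' : ale M M' -> ale N N' -> ale (LetSkip M N) (LetSkip M' N')
| a_tt : ale TT TT
| a_ff : ale FF FF
| a_if P P' M M' N N' :
    ale P P' -> ale M M' -> ale N N' -> ale (If P M N) (If P' M' N')
| a_and : ale And And
| a_xor : ale Xor Xor
| a_not : ale Not Not
| a_inj1 M M' : ale M M' -> ale (Inj1 M) (Inj1 M')
| a_inj2 M M' : ale M M' -> ale (Inj2 M) (Inj2 M')
| a_match P P' M M' N N' :
    ale P P' -> ale M M' -> ale N N' -> ale (Match P M N) (Match P' M' N')
| a_split : ale Split Split
| a_Y M M' : ale M M' -> ale (Y M) (Y M').

#[local] Hint Constructors ale : core.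

Lemma ale_refl M : ale M M.
Proof. by elim: M; auto. Qed.

#[local] Hint Resolve ale_refl : core.

Lemma ale_trans M N P : ale M N -> ale N P -> ale M P.
Proof.
move=> h; elim: h P => //; try by (move=> *; auto).
all: by move=> *; match goal with H : ale (_ _) _ |- _ => inv H end; auto.
Qed.

Lemma ale_plug E M N : ale M N -> ale (plug E M) (plug E N).
Proof. by move=> h; elim: E => //=; auto. Qed.

Lemma ale_shift c M M' : ale M M' -> ale (shift c M) (shift c M').
Proof. by move=> h; elim: h c => /=; auto. Qed.

Lemma ale_subst k M M' N N' : ale M M' -> ale N N' -> ale (subst k N M) (subst k N' M').
Proof.
move=> h; elim: h k N N' => /=; try by (move=> *; auto using ale_shift).
by move=> i k N N' h; case: ifP => // _; case: ifP.
Qed.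

Lemma ale_bconst b X : ale (bconst b) X -> X = bconst b.
Proof. by case: b => h; inv h. Qed.

(* Redexes are left-linear and never contain Err, so they survive its
   replacement by arbitrary terms. *)
Lemma par_ale M N M1 : par M N -> ale M M1 -> exists2 N1, par M1 N1 & ale N N1.
Proof.
move=> h; elim: h M1.
all: intros;
  repeat match goal with
  | H : ale (bconst _) _ |- _ => apply ale_bconst in H; subst
  | H : ale (_ _) _ |- _ => inv H
  | H : ale (_ _ _) _ |- _ => inv H
  | H : ale (_ _ _ _) _ |- _ => inv H
  | H : ale TT _ |- _ => inv H
  | H : ale FF _ |- _ => inv H
  | H : ale Skip _ |- _ => inv H
  | H : ale Split _ |- _ => inv H
  | H : ale And _ |- _ => inv H
  | H : ale Xor _ |- _ => inv H
  | H : ale Not _ |- _ => inv H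
  end;
  repeat match goal with
  | IH : (forall M1, ale ?A M1 -> _), H : ale ?A _ |- _ =>
    let Q := fresh in have [? ? Q] := IH _ H; clear IH
  end.
all: try by (eexists; [constructor; eassumption | auto]).
all: eauto using ale_subst.
Qed.

(** * Subject reduction *)

(* Typing without free variables, and with lists not only folded but also
   unfolded: [split M -> M] turns a term of type [TSum _ _] into one of type
   [TList _], so [has_type] is not stable under reduction. *)
Inductive ht : seq ty -> term -> ty -> Prop :=
| ht_bvar G k : k < size G -> ht G (BVar k) (nth TUnit G k)
| ht_lam G M A B : ht (A :: G) M B -> ht G (Lam M) (TArrow A B)
| ht_app G M N A B : ht G M (TArrow A B) -> ht G N A -> ht G (App M N) B
| ht_pair G M N A B : ht G M A -> ht G N B -> ht G (Pair M N) (TProd A B)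
| ht_proj1 G M A B : ht G M (TProd A B) -> ht G (Proj1 M) A
| ht_proj2 G M A B : ht G M (TProd A B) -> ht G (Proj2 M) B
| ht_skip G : ht G Skip TUnit
| ht_letskip G M N A : ht G M TUnit -> ht G N A -> ht G (LetSkip M N) A
| ht_tt G : ht G TT TBit
| ht_ff G : ht G FF TBit
| ht_if G P M N C : ht G P TBit -> ht G M C -> ht G N C -> ht G (If P M N) C
| ht_and G : ht G And (TArrow (TProd TBit TBit) TBit)
| ht_xor G : ht G Xor (TArrow (TProd TBit TBit) TBit)
| ht_not G : ht G Not (TArrow TBit TBit)
| ht_inj1 G M A B : ht G M A -> ht G (Inj1 M) (TSum A B)
| ht_inj2 G M A B : ht G M B -> ht G (Inj2 M) (TSum A B)
| ht_match G P M N A B C :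
    ht G P (TSum A B) -> ht (A :: G) M C -> ht (B :: G) N C -> ht G (Match P M N) C
| ht_split G A : ht G Split (TArrow (TList A) (TSum TUnit (TProd A (TList A))))
| ht_fold G M A : ht G M (TSum TUnit (TProd A (TList A))) -> ht G M (TList A)
| ht_unfold G M A : ht G M (TList A) -> ht G M (TSum TUnit (TProd A (TList A)))
| ht_Y G M A : ht G M (TArrow A A) -> ht G (Y M) A
| ht_err G A : ht G Err A.

#[local] Hint Constructors ht : core.

Lemma ht_bconst G b : ht G (bconst b) TBit.
Proof. by case: b. Qed.

Lemma has_type_ht xs f G M A : has_type (bit_ctx xs) G M A ->
  (forall x, x \in xs -> f x <> None) -> ht G (fsubst_bool f M) A.
Proof.
move=> + hf; elim=> /=; eauto.
move=> {}G x {}A; rewrite /bit_ctx; case: ifP => // /hf; case: (f x) => // b _ [<-].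
exact: ht_bconst.
Qed.

Lemma ht_shift G1 G2 B M A :
  ht (G1 ++ G2) M A -> ht (G1 ++ B :: G2) (shift (size G1) M) A.
Proof.
move E: (G1 ++ G2) => G h; elim: h G1 E => /=; eauto.
- move=> {}G k kG G1 ?; subst G; case: ifP => h.
    have -> : nth TUnit (G1 ++ G2) k = nth TUnit (G1 ++ B :: G2) k.+1.
      rewrite !nth_cat; have -> : (k < size G1) = false by lia.
      have -> : (k.+1 < size G1) = false by lia.
      by rewrite subSn.
    by constructor; move: kG; rewrite !size_cat /=; lia.
  have -> : nth TUnit (G1 ++ G2) k = nth TUnit (G1 ++ B :: G2) k.
    by rewrite !nth_cat; have -> : (k < size G1) by lia.
  by constructor; move: kG; rewrite !size_cat /=; lia.
- by move=> {}G {}M {}A C _ IH G1 E; constructor; apply: (IH (A :: G1)); rewrite -E.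
- move=> {}G P {}M N {}A C D _ IHP _ IHM _ IHN G1 E; apply: ht_match; first exact: IHP.
  + by apply: (IHM (A :: G1)); rewrite -E.
  + by apply: (IHN (C :: G1)); rewrite -E.
Qed.

Lemma ht_subst G1 G2 B M N A :
  ht (G1 ++ B :: G2) M A -> ht (G1 ++ G2) N B -> ht (G1 ++ G2) (subst (size G1) N M) A.
Proof.
move E: (G1 ++ B :: G2) => G h; elim: h G1 N E => /=; eauto.
- move=> {}G k kG G1 N ?; subst G => hN; case: (k =P size G1) => [->|h].
    by rewrite nth_cat ltnn subnn.
  case: ifP => h'.
    have -> : nth TUnit (G1 ++ B :: G2) k = nth TUnit (G1 ++ G2) k.-1.
      rewrite !nth_cat; have -> : (k < size G1) = false by lia.
      have -> : (k.-1 < size G1) = false by lia.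
      by have -> : k - size G1 = (k.-1 - size G1).+1 by lia.
    by constructor; move: kG; rewrite !size_cat /=; lia.
  have kk : k < size G1 by lia.
  have -> : nth TUnit (G1 ++ B :: G2) k = nth TUnit (G1 ++ G2) k.
    by rewrite !nth_cat kk.
  by constructor; move: kG; rewrite !size_cat /=; lia.
- move=> {}G {}M {}A C _ IH G1 N E hN; constructor.
  by apply: (IH (A :: G1)); rewrite -?E //; apply: (@ht_shift [::]).
- move=> {}G P {}M M2 {}A C D _ IHP _ IHM _ IHN G1 N E hN; apply: ht_match; first exact: IHP.
  + by apply: (IHM (A :: G1)); rewrite -?E //; apply: (@ht_shift [::]).
  + by apply: (IHN (C :: G1)); rewrite -?E //; apply: (@ht_shift [::]).
Qed.

(** Folding and unfolding leave the term unchanged, so the last typing rule is not determined by it.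
    Induction shows that among the introduction forms only injections can be affected, whence their
    two admissible types, sum and list. *)
Lemma ht_inv G T A : ht G T A ->
  match T with
  | FVar _ => False
  | Lam M => exists B C, A = TArrow B C /\ ht (B :: G) M C
  | Pair M N => exists B C, [/\ A = TProd B C, ht G M B & ht G N C]
  | Inj1 M => match A with TSum B _ => ht G M B | TList _ => ht G M TUnit | _ => False end
  | Inj2 M => match A with
              | TSum _ B => ht G M B
              | TList B => ht G M (TProd B (TList B))
              | _ => False
              end
  | Split => exists B, A = TArrow (TList B) (TSum TUnit (TProd B (TList B)))
  | Skip => A = TUnit
  | TT | FF => A = TBit
  | Not => A = TArrow TBit TBit
  | And | Xor => A = TArrow (TProd TBit TBit) TBit
  | _ => True
  end.
Proof.
elim=> //=; eauto 6.
- by move=> {T A}G M N A B hM _ hN _; exists A, B.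
- by move=> {T A}G M A _; case: M => //= [M [B [C []]]|M N [B [C []]]|[B]].
- by move=> {T A}G M A _; case: M => //= [M [B [C []]]|M N [B [C []]]|[B]].
Qed.

Lemma ht_par G M N A : ht G M A -> par M N -> ht G N A.
Proof.
have bT H b : ht H (bconst b) TBit := ht_bconst H b.
move=> h; elim: h N; try by (move=> *; eauto; match goal with H : par _ _ |- _ => inv H end; eauto).
- move=> {}G {}M N {}A B hM IHM hN IHN P h; inv h; eauto.
  (* The induction hypothesis types the reduced abstraction as a whole; inverting that typing yields
     the reduced body. *)
  + have /ht_inv[_ [_ [[<- <-] ?]]] := IHM _ (p_lam H1).
    exact: (@ht_subst [::]) (IHN _ H3).
  (* The rule for [split]: the argument has a list type where its unfolding is expected. *)
  + by case: (ht_inv hM) => B' [? ->]; subst; apply: ht_unfold; apply: IHN.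
  + by case: (ht_inv hM) => _ ->.
  + by case: (ht_inv hM) => _ ->.
  + by case: (ht_inv hM) => _ ->.
- move=> {}G {}M {}A B hM IH N h; inv h; eauto.
  by have /ht_inv[_ [_ [[<- <-] ? ?]]] := IH _ (p_pair H0 (par_refl _)).
- move=> {}G {}M {}A B hM IH N h; inv h; eauto.
  by have /ht_inv[_ [_ [[<- <-] ? ?]]] := IH _ (p_pair (par_refl _) H0).
- move=> {}G P {}M N {}A B C hP IHP hM IHM hN IHN Q h; inv h; eauto.
  + have /ht_inv ? := IHP _ (p_inj1 H3); exact: (@ht_subst [::]) (IHM _ H4) _.
  + have /ht_inv ? := IHP _ (p_inj2 H3); exact: (@ht_subst [::]) (IHN _ H4) _.
Qed.

Lemma ht_star_par G M N A : star par M N -> ht G M A -> ht G N A.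
Proof. by elim=> // a b c ab _ IH /ht_par - /(_ _ ab) /IH. Qed.

(** * Tuples of bits *)

Definition opt_bit (f : nat -> option bool) (x : nat) : term :=
  if f x is Some b then bconst b else FVar x.

Lemma fsubst_tup f ps :
  fsubst_bool f (tup (map FVar ps)) = tup (map (opt_bit f) ps).
Proof. by elim: ps => //= p [|q ps] //= ->. Qed.

(** No free variable is typable in [ht], so each component is a constant of type [TBit]. Since
    [TBit], [TUnit] and products are distinct types, the nesting of [bitn m] then fixes the
    length. *)
Lemma ht_tup_size f ps m : ht [::] (tup (map (opt_bit f) ps)) (bitn m) ->
  size ps = m /\ exists bs, map (opt_bit f) ps = map bconst bs.
Proof.
have hb p A : ht [::] (opt_bit f p) A -> A = TBit /\ exists b, opt_bit f p = bconst b.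
  rewrite /opt_bit; case: (f p) => [b|] /ht_inv //; case: b => //= ->; split=> //.
    by exists true.
  by exists false.
elim: ps m => [|p [|q ps] IH] m /=.
- by move/ht_inv; case: m => [|[|m]] //= _; split=> //; exists [::].
- move=> /hb[]; case: m => [|[|m]] //= _ [b ->].
  by split=> //; exists [:: b].
- move/ht_inv=> [B [C [E /hb[? [b ->]] hC]]]; case: m E => [|[|m]] //= [_ EC].
  rewrite -EC in hC; have [/= -> [bs Ebs]] := IH m.+1 hC.
  by split=> //; exists (b :: bs); rewrite /= -Ebs.
Qed.

Lemma ale_tup f ps X : ale (tup (map (opt_bit f) ps)) X -> X = tup (map (opt_bit f) ps).
Proof.
have hb p Z : ale (opt_bit f p) Z -> Z = opt_bit f p.
  by rewrite /opt_bit; case: (f p) => [[]|] h; inv h.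
elim: ps X => [|p [|q ps] IH] X /= h; first by inv h.
  exact: hb.
by inv h; rewrite (IH _ H3) (hb _ _ H1).
Qed.

Lemma star_par_tup bs X : star par (tup (map bconst bs)) X -> X = tup (map bconst bs).
Proof.
have n Z : par (tup (map bconst bs)) Z -> Z = tup (map bconst bs).
  elim: bs Z => [|b [|c bs] IH] Z /= h; first by inv h.
    exact: par_bconst.
  by inv h; rewrite (IH _ H3) (par_bconst H1).
move E: (tup _) => T h; elim: h n E => // a b c ab _ IH n E; subst.
by rewrite (n _ ab) in IH *; apply: IH.
Qed.

(** * Reduction of the tuple binding *)

(** The chain of bindings inside [let_tuple], with its variable [z] generalised to a term [A], since
    contracting the outer binding puts the tuple itself there. *)
Definition lets (n : nat) (l : seq (nat * nat)) (A B : term) : term :=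
  foldr (fun ix body => let_in ix.2 (nproj n ix.1 A) body) B l.

Lemma lc_nproj k n i A : lc k (nproj n i A) = lc k A.
Proof. by rewrite /nproj; case: ifP => _ /=; elim: i.-1. Qed.

Lemma lc_lets n l A B : lc 0 A -> lc 0 B -> lc 0 (lets n l A B).
Proof.
move=> hA hB; elim: l => //= ix l IH.
by rewrite lc_nproj hA andbT; apply: lc_close.
Qed.

Lemma nsubst_nproj f n i A : nsubst f (nproj n i A) = nproj n i (nsubst f A).
Proof.
rewrite /nproj; have h j : nsubst f (iter j Proj2 A) = iter j Proj2 (nsubst f A).
  by elim: j => //= j ->.
by case: ifP => _ /=; rewrite h.
Qed.

Lemma nsubst_lets f n (l : seq (nat * nat)) A B :
  closed_images f -> {in map snd l, forall x, f x = None} ->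
  nsubst f (lets n l A B) = lets n l (nsubst f A) (nsubst f B).
Proof.
move=> cf; elim: l => //= ix l IH hl.
rewrite nsubst_nproj nsubst_close ?IH //.
- by move=> x hx; apply: hl; rewrite inE hx orbT.
- by apply: hl; rewrite inE eqxx.
Qed.

Lemma par_let_in x N B : lc 0 B -> closed N -> par (let_in x N B) (nsubst (single x N) B).
Proof. by move=> hB hN; rewrite -(subst_close x hB hN); apply: r_beta. Qed.

Lemma closed_bconst b : closed (bconst b).
Proof. by case: b. Qed.

Lemma closed_tup_bconst bs : closed (tup (map bconst bs)).
Proof.
elim: bs => [|b [|c bs] [h1 h2]] //=; first exact: closed_bconst.
rewrite /closed /= in h1 h2 *; rewrite h1 h2 cats0.
by case: (closed_bconst b) => -> ->.
Qed.

Lemma nproj_tup bs i : i < size bs ->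
  star par (nproj (size bs) i.+1 (tup (map bconst bs))) (bconst (nth false bs i)).
Proof.
have pr A A' : star par A A' -> star par (Proj2 A) (Proj2 A').
  by apply: star_map => a b ab; apply: star1; auto.
have pl A A' : star par A A' -> star par (Proj1 A) (Proj1 A').
  by apply: star_map => a b ab; apply: star1; auto.
move=> hi; have {}pr j : j <= i ->
    star par (iter j Proj2 (tup (map bconst bs))) (tup (map bconst (drop j bs))).
  elim: j => [|j IH] ji; first by rewrite drop0; apply: star_refl.
  apply: star_trans (pr _ _ (IH _)) _; first by lia.
  rewrite (drop_nth false (n := j)); last by lia.
  rewrite (drop_nth false (n := j.+1)); last by lia.
  by apply: star1 => /=; auto.
(* At the last position the remaining suffix has one entry, and its [tup] is that entry, so no
   [Proj1] is applied. *)
rewrite /nproj /=; case: (i.+1 =P size bs) => h.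
  apply: star_trans (pr _ (leqnn _)) _.
  by rewrite (drop_nth false) // h drop_size; apply: star_refl.
apply: star_trans (pl _ _ (pr _ (leqnn _))) _.
rewrite (drop_nth false) // (drop_nth false (n := i.+1)); last by lia.
by apply: star1 => /=; auto.
Qed.

Definition mask_out (s : seq nat) (f : nat -> option term) : nat -> option term :=
  fun x => if x \in s then None else f x.

Lemma closed_mask_out s f : closed_images f -> closed_images (mask_out s f).
Proof. by move=> cf y N; rewrite /mask_out; case: ifP => // _; apply: cf. Qed.

(** The mask holds the names whose binding is still pending. Contracting the outermost binding
    removes its name from the mask: names are distinct and images closed, so the single substitution
    passes the inner binders and merges with [h]. *)
Lemma lets_star bs (l : seq (nat * nat)) h M : lc 0 M -> closed_images h -> uniq (map snd l) ->
  (forall i x, (i, x) \in l ->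
     [/\ 0 < i, i <= size bs & h x = Some (bconst (nth false bs i.-1))]) ->
  star par (lets (size bs) l (tup (map bconst bs)) (nsubst (mask_out (map snd l) h) M))
           (nsubst h M).
Proof.
move=> lM ch; elim: l => [|[i x] l IH] /=.
  by move=> _ _; rewrite (@eq_nsubst _ h) //; apply: star_refl.
move=> /andP[xl ul] hl.
have [i0 ib hx] := hl i x (mem_head _ _).
have [cb fb] := closed_tup_bconst bs.
set B := lets _ _ _ _.
have lB : lc 0 B.
  by apply: lc_lets => //; apply: lc_nsubst => //; apply: closed_mask_out.
apply: (star_trans (b := let_in x (bconst (nth false bs i.-1)) B)).
  have := nproj_tup (bs := bs) (i := i.-1); rewrite prednK // => /(_ ib).
  by apply: star_map => P Q PQ; apply: star1; apply: p_app.
apply: star_step (par_let_in x lB (closed_bconst _)) _.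
have cs := @closed_single x _ (closed_bconst (nth false bs i.-1)).
rewrite nsubst_lets //; last first.
  by move=> y yl; rewrite /single; case: eqP => // yx; rewrite -yx yl in xl.
rewrite (nsubst_closed _ fb) nsubst_nsubst; last exact: closed_mask_out.
rewrite (@eq_nsubst _ (mask_out (map snd l) h)); last first.
  move=> y _; rewrite /mask_out /single inE; case: (y =P x) => [->|_] /=.
    by rewrite (negbTE xl) hx.
  by case: ifP => // _; case: (h y).
by apply: IH => // j y jy; apply: hl; rewrite inE jy orbT.
Qed.

Lemma fresh_name_notin s : fresh_name s \notin s.
Proof.
have h x : x \in s -> x < fresh_name s.
  rewrite /fresh_name; elim: s => //= y s IH; rewrite inE => /orP[/eqP->|/IH]; lia.
by apply/negP => /h; rewrite ltnn.
Qed.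

Lemma let_tuple_star xs bs M : uniq xs -> lc 0 M -> size bs = size xs ->
  star par (let_tuple xs (tup (map bconst bs)) M)
    (fsubst_bool (fun x => if x \in xs then Some (nth false bs (index x xs)) else None) M).
Proof.
move=> ux lM sz; rewrite /let_tuple -/(lets _ _ _ _).
set z := fresh_name _; set l := zip _ _.
have El : map snd l = xs by apply: unzip2_zip; rewrite size_iota.
have := fresh_name_notin (xs ++ fv M); rewrite -/z mem_cat negb_or => /andP[zx zM].
have [cb fb] := closed_tup_bconst bs.
apply: star_step (par_let_in z _ (conj cb fb)) _; first exact: lc_lets.
rewrite nsubst_lets; first last.
- by rewrite El => x hx; rewrite /single; case: eqP => // xz; rewrite -xz hx in zx.
- exact: closed_single.
rewrite /= {1}/single eqxx /= fsubst_boolE -sz.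
set h := (fun _ => omap _ _).
(* Both sides are [M]: [z] is not free in it, and [h] is masked wherever it is defined. *)
have -> : nsubst (single z (tup (map bconst bs))) M = nsubst (mask_out (map snd l) h) M.
  apply: eq_nsubst => y hy; rewrite /single /mask_out El /h.
  by case: eqP => [yz|_]; [rewrite -yz hy in zM | case: (y \in xs)].
apply: lets_star => //; rewrite ?El //.
  by move=> y N; rewrite /h; case: ifP => // _ [<-]; apply: closed_bconst.
move=> i x /(nthP (0, 0)) [j]; rewrite size_zip size_iota minnn => jx.
rewrite nth_zip ?size_iota // nth_iota // => -[<- <-].
by rewrite /h mem_nth // index_uniq //; split=> //; rewrite sz.
Qed.

(** * Simulation of the abstract machine *)

Lemma closed_images_bool (f : nat -> option bool) :
  closed_images (fun y => omap bconst (f y)).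
Proof. by move=> y N; case: (f y) => //= b [<-]; apply: closed_bconst. Qed.

Lemma eq_fsubst f g M : {in fv M, f =1 g} -> fsubst_bool f M = fsubst_bool g M.
Proof. by move=> h; rewrite !fsubst_boolE; apply: eq_nsubst => y /h ->. Qed.

Lemma fsubst_head_pure f R R' : head_pure R R' ->
  head_pure (fsubst_bool f R) (fsubst_bool f R').
Proof.
have s N M : fsubst_bool f (subst 0 N M) = subst 0 (fsubst_bool f N) (fsubst_bool f M).
  by rewrite !fsubst_boolE; apply: nsubst_subst; apply: closed_images_bool.
by case=> *; rewrite /= ?s; constructor.
Qed.

Fixpoint fsubst_ctx (f : nat -> option bool) (E : ctx) : ctx :=
  let s := fsubst_bool f in
  match E with
  | Hole => Hole
  | CLam E => CLam (fsubst_ctx f E)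
  | CAppL E N => CAppL (fsubst_ctx f E) (s N)
  | CAppR M E => CAppR (s M) (fsubst_ctx f E)
  | CPairL E N => CPairL (fsubst_ctx f E) (s N)
  | CPairR M E => CPairR (s M) (fsubst_ctx f E)
  | CProj1 E => CProj1 (fsubst_ctx f E)
  | CProj2 E => CProj2 (fsubst_ctx f E)
  | CLetSkipL E N => CLetSkipL (fsubst_ctx f E) (s N)
  | CLetSkipR M E => CLetSkipR (s M) (fsubst_ctx f E)
  | CIf1 E M N => CIf1 (fsubst_ctx f E) (s M) (s N)
  | CIf2 P E N => CIf2 (s P) (fsubst_ctx f E) (s N)
  | CIf3 P M E => CIf3 (s P) (s M) (fsubst_ctx f E)
  | CInj1 E => CInj1 (fsubst_ctx f E)
  | CInj2 E => CInj2 (fsubst_ctx f E)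
  | CMatch1 E M N => CMatch1 (fsubst_ctx f E) (s M) (s N)
  | CMatch2 P E N => CMatch2 (s P) (fsubst_ctx f E) (s N)
  | CMatch3 P M E => CMatch3 (s P) (s M) (fsubst_ctx f E)
  | CY E => CY (fsubst_ctx f E)
  end.

Lemma fsubst_plug f E R : fsubst_bool f (plug E R) = plug (fsubst_ctx f E) (fsubst_bool f R).
Proof. by elim: E => //= *; f_equal. Qed.

Lemma eq_fsubst_ctx f g E R : {in fv (plug E R), f =1 g} -> fsubst_ctx f E = fsubst_ctx g E.
Proof.
elim: E => //=; intros; f_equal;
  match goal with
  | IH : _ -> ?a = ?b |- ?a = ?b => apply: IH => y hy
  | |- fsubst_bool _ _ = _ => apply: eq_fsubst => y hy
  end;
  match goal with H : {in _, _} |- _ => apply: H; rewrite ?mem_cat hy ?orbT end; done.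
Qed.

(** A machine step changes the valuation along with the term. Agreement on the names of the source
    makes both readbacks of the context equal, leaving only the redex to compare. *)
Lemma par_fsubst_plug f g E R R' : {in fv (plug E R), f =1 g} ->
  par (fsubst_bool f R) (fsubst_bool g R') ->
  par (fsubst_bool f (plug E R)) (fsubst_bool g (plug E R')).
Proof. by move=> h hR; rewrite !fsubst_plug (eq_fsubst_ctx h); apply: par_plug. Qed.

(** * Effect of the generated gates *)

Lemma exec_gate_neq g v l : l != target g -> exec_gate g v l = v l.
Proof. by rewrite /exec_gate => /negbTE ->. Qed.

(** A new wire is neither an input nor a target, so it still holds its initial value; a gate's
    exclusive-or into it then simply stores the conjunction of the controls. *)
Lemma exec_circuit_new I C L u w : new_wire I C L w -> exec_circuit I C u w = false.
Proof.
case=> wI [wC _]; rewrite /exec_circuit; elim: C wC => [|g C IH] /=.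
  by rewrite (negbTE wI).
rewrite /wires /= inE mem_cat !negb_or => /andP[h /andP[_ h']].
by rewrite exec_gate_neq // IH.
Qed.

Lemma fresh_agree1 I C L M p i0 (v v' : nat -> bool) :
  fresh_var L M p -> new_wire I C L i0 -> (forall l, l != i0 -> v' l = v l) ->
  {in fv M, (fun x => omap v (L x)) =1 (fun x => omap v' (extL L p i0 x))}.
Proof.
move=> [_ pM] [_ [_ hL]] hv y hy; rewrite /extL.
case: eqP => [yp|_]; first by rewrite -yp hy in pM.
case E: (L y) => [w|] //=; rewrite hv //.
by apply/eqP => wi; apply: (hL y); rewrite E wi.
Qed.

(** A multiplexer: the two gates on a target read [wq] with opposite signs, so at most the one of
    the selected branch fires. All controls lie outside [us], hence different targets do not
    interfere. *)
Lemma exec_if_gates L wq us vs ws v :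
  uniq us -> size vs = size us -> size ws = size us ->
  {in us, forall l, v l = false} -> wq \notin us ->
  {in vs, forall y, wire_of L y \notin us} -> {in ws, forall y, wire_of L y \notin us} ->
  let v' := foldr exec_gate v (if_gates L wq us vs ws) in
  (forall l, l \notin us -> v' l = v l) /\
  map v' us = map (fun y => v (wire_of L y)) (if v wq then vs else ws).
Proof.
elim: us vs ws => [|t us IH] [|y vs] [|z ws] //=; first by case: ifP.
move=> /andP[tu uu] [sv] [sw] v0; rewrite inE negb_or => /andP[qt qu] hv hw.
case: (IH vs ws) => //.
- by move=> l hl; apply: v0; rewrite inE hl orbT.
- by move=> x hx; have := hv x; rewrite !inE hx orbT negb_or => /(_ isT) /andP[].
- by move=> x hx; have := hw x; rewrite !inE hx orbT negb_or => /(_ isT) /andP[].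
rewrite -/(if_gates L wq us vs ws); set v1 := foldr _ _ _ => h1 h2.
have /andP[yt yu] : (wire_of L y != t) && (wire_of L y \notin us).
  by rewrite -negb_or -[_ || _]in_cons; apply: hv; rewrite inE eqxx.
have /andP[_ zu] : (wire_of L z != t) && (wire_of L z \notin us).
  by rewrite -negb_or -[_ || _]in_cons; apply: hw; rewrite inE eqxx.
split.
  move=> l; rewrite inE negb_or => /andP[lt lu].
  by rewrite !exec_gate_neq // h1.
have -> : map (exec_gate (Gate t [:: (true, wq); (true, wire_of L y)])
     (exec_gate (Gate t [:: (false, wq); (true, wire_of L z)]) v1)) us = map v1 us.
  apply/eq_in_map => l lu; have lt : l != t by apply: contraNneq tu => <-.
  by rewrite !exec_gate_neq.
rewrite h2 /exec_gate /= !eqxx (negbTE qt) (negbTE yt) !h1 //.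
rewrite v0 ?mem_head // !andbT.
by case: (v wq) => /=; case: (v (wire_of L y)); case: (v (wire_of L z)).
Qed.

(** * First-order extensions *)

Lemma foldr_extL_notin L ps y : y \notin unzip1 ps ->
  foldr (fun t L' => extL L' t.1 t.2) L ps y = L y.
Proof.
elim: ps => //= -[p w] ps IH; rewrite inE negb_or => /andP[yp /IH <-].
by rewrite /extL /= (negbTE yp).
Qed.

Lemma map_foldr_extL L us ws : uniq us -> size ws = size us ->
  map (foldr (fun t L' => extL L' t.1 t.2) L (zip us ws)) us = map Some ws.
Proof.
elim: us ws => [|x us IH] [|w ws] //= /andP[xu uu] [sz].
rewrite {1}/extL eqxx; congr cons; rewrite -IH //.
by apply/eq_in_map => y yu; rewrite /extL; case: eqP => // yx; rewrite -yx yu in xu.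
Qed.

(** [fot] occurs inside [seq] in its own definition; the [foldr] conjunction is the induction
    hypothesis for all entries of a list. *)
Lemma fot_nested_ind (P : fot -> Prop) :
  (forall x, P (FOVar x)) ->
  (forall V W, P V -> P W -> P (FOPair V W)) ->
  (forall Vs, foldr (fun V Q => P V /\ Q) True Vs -> P (FOList Vs)) ->
  forall V, P V.
Proof.
move=> hv hp hl; fix IH 1; case=> [x|V W|Vs]; [exact: hv | by apply: hp | apply: hl].
by elim: Vs => //= V Vs h; split.
Qed.

Lemma size_fot_vars U V : fot_shape U = fot_shape V ->
  size (fot_vars U) = size (fot_vars V).
Proof.
elim/fot_nested_ind: U V => [x|U1 U2 IH1 IH2|Us IH] [y|V1 V2|Vs] //=.
  by case=> /IH1 h1 /IH2 h2; rewrite !size_cat h1 h2.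
case; elim: Us Vs IH => [|U Us IHs] [|V Vs] //= [IH /IHs {}IHs] [/IH h /IHs {}IHs].
by rewrite !size_cat h IHs.
Qed.

(** Such a term is determined by its shape and the values of its variables in order. The values must
    be defined, as an unassigned variable would read back as its own name. *)
Lemma fsubst_fot f g U V : fot_shape U = fot_shape V ->
  map f (fot_vars U) = map g (fot_vars V) -> {in fot_vars V, forall y, g y <> None} ->
  fsubst_bool f (fot_term U) = fsubst_bool g (fot_term V).
Proof.
have cat (s1 s2 t1 t2 : seq nat) : size s1 = size t1 ->
    map f (s1 ++ s2) = map g (t1 ++ t2) -> map f s1 = map g t1 /\ map f s2 = map g t2.
  move=> sz; rewrite !map_cat => /eqP; rewrite eqseq_cat ?size_map //.
  by case/andP=> /eqP ? /eqP.
elim/fot_nested_ind: U V => [x|U1 U2 IH1 IH2|Us IH] [y|V1 V2|Vs] //=.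
- by move=> _ [->] /(_ y (mem_head _ _)); case: (g y).
- move=> [h1 h2] /cat [|e1 e2 hg]; first exact: size_fot_vars.
  rewrite (IH1 V1) ?(IH2 V2) // => y hy; apply: hg; rewrite mem_cat hy ?orbT //.
case; elim: Us Vs IH => [|U Us IHs] [|V Vs] //= [IH /IHs {}IHs] [h h'].
move=> /cat [|e1 e2 hg]; first exact: size_fot_vars.
rewrite (IH V) ?(IHs Vs) // => y hy; apply: hg; rewrite mem_cat hy ?orbT //.
Qed.

Lemma wire_of_new L (ws : seq nat) y : L y <> None -> {in ws, forall w, L y <> Some w} ->
  wire_of L y \notin ws.
Proof.
rewrite /wire_of; case: (L y) => // w _ h; apply/negP => /h; exact.
Qed.

(* Contracting a conditional whose branches have different shapes yields [Err]:
   there the readback does not reduce but becomes less defined. *)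
Lemma am_step_readback S S' u : am_step S S' ->
  par (readback S u) (readback S' u) \/ ale (readback S' u) (readback S u).
Proof.
case=> {S S'}; rewrite /readback /=.
- move=> E R R' I C L h; left; apply: par_fsubst_plug => //.
  by apply: head_pure_par; apply: fsubst_head_pure.
- move=> E I C L p i0 hp hw; left; apply: par_fsubst_plug.
    by apply: fresh_agree1 hp hw _ => l _.
  by rewrite /= /extL eqxx /= (exec_circuit_new _ hw).
- move=> E I C L p i0 hp hw; left; apply: par_fsubst_plug.
    by apply: fresh_agree1 hp hw _ => l li; apply: exec_gate_neq.
  rewrite /= /extL eqxx /= /exec_gate /= eqxx.
  by rewrite -/(exec_circuit I C u) (exec_circuit_new _ hw).
- move=> E I C L q wq p i0 hq hp hw; left; apply: par_fsubst_plug.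
    by apply: fresh_agree1 hp hw _ => l li; apply: exec_gate_neq.
  rewrite /= /extL eqxx /= /exec_gate /= eqxx hq /= -/(exec_circuit I C u).
  by rewrite (exec_circuit_new _ hw) addbF addbT andbT; apply: r_not.
- move=> E I C L q1 q2 w1 w2 p i0 h1 h2 hp hw; left; apply: par_fsubst_plug.
    by apply: fresh_agree1 hp hw _ => l li; apply: exec_gate_neq.
  rewrite /= /extL eqxx /= /exec_gate /= eqxx h1 h2 /= -/(exec_circuit I C u).
  by rewrite (exec_circuit_new _ hw) !addbT !negbK andbT; apply: r_and.
- move=> E I C L q1 q2 w1 w2 p i0 h1 h2 hp hw; left; apply: par_fsubst_plug.
    by apply: fresh_agree1 hp hw _ => l li; rewrite /= !exec_gate_neq.
  (* The gate reading [w1] is executed second, when [i0] has already changed. *)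
  have n1 : (w1 == i0) = false by apply/eqP => e; apply: (hw.2.2 q1); rewrite h1 e.
  rewrite /= /extL eqxx /= /exec_gate /= !eqxx h1 h2 /= n1 -/(exec_circuit I C u).
  by rewrite (exec_circuit_new _ hw) !addbT !negbK !andbT addbC; apply: r_xor.
- move=> E I C L q wq V W U ws hq hV hW sVW sUV uU fU szw uw hw; left.
  set v := exec_circuit I C u; set v' := exec_circuit I _ u.
  have szV : size (fot_vars V) = size ws by rewrite szw (size_fot_vars sUV).
  have szW : size (fot_vars W) = size ws by rewrite -szV (size_fot_vars sVW).
  have Lnew y : {in ws, forall w, L y <> Some w} by move=> w /hw [_ [_]].
  have [||||h1 h2] := @exec_if_gates L wq ws (fot_vars V) (fot_vars W) v uw szV szW.
  + by move=> l /hw; apply: exec_circuit_new.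
  + by have := @wire_of_new L ws q; rewrite /wire_of hq; apply=> //; rewrite -hq; apply: Lnew.
  + by move=> y hy; apply: wire_of_new => //; apply: hV.
  + by move=> y hy; apply: wire_of_new => //; apply: hW.
  have Ev : foldr exec_gate v (if_gates L wq ws (fot_vars V) (fot_vars W)) = v'.
    by rewrite /v' /v /exec_circuit foldr_cat.
  rewrite {}Ev in h1 h2; apply: par_fsubst_plug.
    move=> y hy; rewrite foldr_extL_notin; last first.
      rewrite unzip1_zip ?szw //; apply/negP => /fU [_]; by rewrite hy.
    case EL: (L y) => [w|] //=; rewrite h1 //; apply/negP => /(Lnew y); exact.
  set L' := foldr _ _ _.
  (* The variables of [U] now read what those of the selected branch read before; equality of shapes
     turns this into equality of readbacks. *)
  have EU : map (fun x => omap v' (L' x)) (fot_vars U) =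
            map (fun x => omap v (L x)) (if v wq then fot_vars V else fot_vars W).
    rewrite (map_comp (omap v') L') map_foldr_extL // -map_comp.
    rewrite (map_comp Some v') h2 -map_comp; apply/eq_in_map => y hy /=.
    have : L y <> None by case: (v wq) hy => [/hV|/hW].
    by rewrite /wire_of; case: (L y).
  rewrite /= hq /=; case Eq: (v wq) EU => EU /=.
  + rewrite (fsubst_fot sUV EU); first by auto.
    by move=> y /hV; case: (L y).
  + rewrite (fsubst_fot (etrans sUV sVW) EU); first by auto.
    by move=> y /hW; case: (L y).
- move=> E I C L q wq V W hq hV hW _; right.
  by rewrite !fsubst_plug; apply: ale_plug.
Qed.

(** By induction with an arbitrary [N] above the current readback: a parallel step of the readback
    is lifted to [N] by [par_ale], while a step to [Err] only lowers the readback, so [N] stays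
    above it by transitivity. *)
Lemma am_star_readback S S' u : star am_step S S' ->
  exists2 N, star par (readback S u) N & ale (readback S' u) N.
Proof.
have sim A B N : par A B -> ale A N -> exists2 N', star par N N' & ale B N'.
  by move=> h k; have [N' ? ?] := par_ale h k; exists N' => //; apply: star1.
suff gen N : star am_step S S' -> ale (readback S u) N ->
    exists2 N', star par N N' & ale (readback S' u) N' by move/gen; apply.
move=> h; elim: h N => [{}S|{}S T {}S' ST _ IH] N hN; first by exists N => //; apply: star_refl.
case: (am_step_readback u ST) => [/sim /(_ hN)[N1 NN1 hN1]|h].
  by have [N2 h1 h2] := IH _ hN1; exists N2 => //; apply: star_trans NN1 h1.
by apply: IH; apply: ale_trans hN.
Qed.

Theorem theorem4 (xs : seq nat) (m : nat) (M : term)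
    (ps : seq nat) (I : seq nat) (C : seq gate) (L : nat -> option nat) :
  uniq xs ->
  has_type (bit_ctx xs) [::] M (bitn m) ->
  star am_step (EmptyAM xs M) (AM (tup (map FVar ps)) I C L) ->
  size ps = m /\
  forall (u : nat -> bool) (cs : seq bool),
    size cs = m ->
    (readback (AM (tup (map FVar ps)) I C L) u = tup (map bconst cs)
     <->
     star step
       (let_tuple xs (tup [seq bconst (u i) | i <- iota 1 (size xs)]) M)
       (tup (map bconst cs))).
Proof.
move=> ux hM hS; set S' := AM _ _ _ _.
have S0 u : star par (readback (EmptyAM xs M) u) (readback S' u) /\
    size ps = m /\ exists bs, readback S' u = tup (map bconst bs).
  have [N hN] := am_star_readback u hS.
  rewrite [readback S' u]/readback /= fsubst_tup => /ale_tup EN.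
  rewrite EN in hN; split=> //.
  have /(ht_star_par hN) /ht_tup_size : ht [::] (readback (EmptyAM xs M) u) (bitn m).
    by apply: has_type_ht hM _ => x /= ->.
  by case=> -> [bs ->]; split=> //; exists bs.
split; first by case: (S0 (fun _ => false)) => _ [].
move=> u cs _; have [hS' [_ [bs Ebs]]] := S0 u.
have lt : star par (let_tuple xs (tup [seq bconst (u i) | i <- iota 1 (size xs)]) M)
            (readback S' u).
  apply: star_trans hS'; rewrite (map_comp bconst u).
  (* The empty circuit returns its inputs. Wires are numbered from 1 and list positions from 0,
     hence the shift between [(index x xs).+1] and [index x xs]. *)
  have -> : readback (EmptyAM xs M) u = fsubst_bool (fun x => if x \in xs
      then Some (nth false (map u (iota 1 (size xs))) (index x xs)) else None) M.
    apply: eq_fsubst => x _ /=; case: ifP => //= hx; congr Some.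
    have ix : index x xs < size xs by rewrite index_mem.
    have -> : (index x xs).+1 \in iota 1 (size xs) by rewrite mem_iota; lia.
    by rewrite (nth_map 0) ?size_iota ?nth_iota.
  apply: let_tuple_star => //; first exact: has_type_lc hM.
  by rewrite size_map size_iota.
split=> [<-|h].
  exact: (@star_map _ _ par step id par_star_step).
have {}h : star par (let_tuple xs (tup [seq bconst (u i) | i <- iota 1 (size xs)]) M)
            (tup (map bconst cs)).
  by apply: (@star_map _ _ step par id) h => a b /step_par; apply: star1.
(* Both tuples are normal, so their common reduct [Q] equals each of them. *)
have [Q] := par_confluent lt h.
by rewrite Ebs => /star_par_tup -> /star_par_tup.
Qed.
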